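(* Let $\rho$ be an $N$-qubit density matrix and let $\mathsf K_1,\dots,\mathsf K_L\subseteq\{1,\dots,N\}$ be subsystems with $K=\max_l|\mathsf K_l|$. Fix $\epsilon,\delta\in(0,1)$. Let $\hat\sigma_1,\dots,\hat\sigma_M$ be independent SIC POVM classical shadows of $\rho$ with $$M\ge 6L\,3^K/(\epsilon^2\delta),$$ and for each subsystem $\mathsf K$ define $\hat p_{\mathsf K}=\binom{M}{2}^{-1}\sum_{1\le m<m'\le M}\mathrm{tr}\big(\mathrm{tr}_{\neg\mathsf K}(\hat\sigma_m)\,\mathrm{tr}_{\neg\mathsf K}(\hat\sigma_{m'})\big)$. Then with probability at least $1-\delta$, $$\max_{1\le l\le L}\big|\hat p_{\mathsf K_l}-\mathrm{tr}(\rho_{\mathsf K_l}^2)\big|\le\epsilon,$$ where $\rho_{\mathsf K}=\mathrm{tr}_{\neg\mathsf K}(\rho)$.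
   Context: Let $|\psi_1\rangle,\dots,|\psi_4\rangle\in\mathbb C^2$ be unit vectors forming a single-qubit SIC set, i.e. $|\langle\psi_i|\psi_j\rangle|^2=1/3$ for all $i\neq j$; then $\{\tfrac12|\psi_i\rangle\langle\psi_i|\}_{i=1}^4$ is a POVM. Performing this measurement on each qubit of an $N$-qubit state $\rho$ yields an outcome string $(i_1,\dots,i_N)\in\{1,2,3,4\}^N$ with probability $2^{-N}\langle\psi_{i_1}\otimes\cdots\otimes\psi_{i_N}|\,\rho\,|\psi_{i_1}\otimes\cdots\otimes\psi_{i_N}\rangle$. The SIC POVM classical shadow associated with this outcome is $\hat\sigma=\bigotimes_{n=1}^N\big(3|\psi_{i_n}\rangle\langle\psi_{i_n}|-\mathbb I\big)$; independent shadows arise from measurements on independent copies of $\rho$. $\mathrm{tr}_{\neg\mathsf K}$ is the partial trace over qubits not in $\mathsf K$. *)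

(* Defs.v *)
From HB Require Import structures.
From mathcomp Require Import all_boot all_order all_algebra.
Set Implicit Arguments. Unset Strict Implicit. Unset Printing Implicit Defensive.
Import Order.TTheory GRing.Theory Num.Theory.
Local Open Scope ring_scope.

Section QDefs.
Variable C : numClosedFieldType.

(* computational basis of N qubits: bit strings *)
Definition config (N : nat) := {ffun 'I_N -> 'I_2}.
(* operators on (C^2)^{\otimes N}, as matrices indexed by bit strings *)
Definition op (N : nat) := config N -> config N -> C.

Definition trace N (A : op N) : C := \sum_(b : config N) A b b.
Definition opmul N (A B : op N) : op N :=
  fun b b' => \sum_(c : config N) A b c * B c b'.

Definition hermitian N (A : op N) := forall b b', A b' b = (A b b')^*.
Definition psd N (A : op N) :=
  hermitian A /\
  forall v : config N -> C, 0 <= \sum_(b : config N) \sum_(b' : config N) (v b)^* * A b b' * v b'.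
Definition density N (rho : op N) := psd rho /\ trace rho = 1.

(* Partial trace over the qubits not in K. The reduced operator on the qubits
   in K is represented on config N, supported on bit strings that are 0 outside K
   (a canonical identification of the K-subsystem basis with such strings). *)
Definition supported N (K : {set 'I_N}) (b : config N) : bool :=
  [forall i, (i \notin K) ==> (b i == ord0)].
Definition merge N (K : {set 'I_N}) (b c : config N) : config N :=
  [ffun i => if i \in K then b i else c i].
Definition ptrace N (K : {set 'I_N}) (A : op N) : op N :=
  fun b b' => if supported K b && supported K b' then
     \sum_(c : config N | supported (~: K) c) A (merge K b c) (merge K b' c)
   else 0.

Definition inner (u v : 'I_2 -> C) : C := \sum_(k < 2) (u k)^* * v k.
Definition sic (psi : 'I_4 -> 'I_2 -> C) :=
  (forall i, inner (psi i) (psi i) = 1) /\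
  (forall i j, i != j -> `|inner (psi i) (psi j)| ^+ 2 = 3^-1).

Definition outcome (N : nat) := {ffun 'I_N -> 'I_4}.

Definition prodvec N (psi : 'I_4 -> 'I_2 -> C) (o : outcome N) (b : config N) : C :=
  \prod_(n < N) psi (o n) (b n).

Definition outcome_prob N (psi : 'I_4 -> 'I_2 -> C) (rho : op N) (o : outcome N) : C :=
  (2%:R ^+ N)^-1 * \sum_(b : config N) \sum_(b' : config N)
     (prodvec psi o b)^* * rho b b' * prodvec psi o b'.

(* SIC POVM classical shadow  ⊗_n (3 |psi_{i_n}><psi_{i_n}| - I) *)
Definition shadow N (psi : 'I_4 -> 'I_2 -> C) (o : outcome N) : op N :=
  fun b b' => \prod_(n < N)
    (3%:R * psi (o n) (b n) * (psi (o n) (b' n))^* - (b n == b' n)%:R).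

Definition seq_prob N M psi (rho : op N) (w : {ffun 'I_M -> outcome N}) : C :=
  \prod_(m < M) outcome_prob psi rho (w m).
Definition Pr N M psi (rho : op N) (E : {ffun 'I_M -> outcome N} -> bool) : C :=
  \sum_(w : {ffun 'I_M -> outcome N} | E w) seq_prob psi rho w.

Definition phat N M psi (K : {set 'I_N}) (w : {ffun 'I_M -> outcome N}) : C :=
  ('C(M, 2))%:R^-1 *
  \sum_(m < M) \sum_(m' < M | (m < m')%N)
     trace (opmul (ptrace K (shadow psi (w m))) (ptrace K (shadow psi (w m')))).

Definition purity N (K : {set 'I_N}) (rho : op N) : C :=
  trace (opmul (ptrace K rho) (ptrace K rho)).

End QDefs.

(* Main.v *)
(** Every qubit of a shadow has trace one, so the purity estimator of a subsystem
K is a U-statistic whose kernel, evaluated at two outcomes, is the product over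
the qubits of K of g, where g = 5 if the two outcomes agree and g = -1 otherwise.
The matrices (3 P_i - 1)/2 are biorthogonal to the SIC projectors P_i, hence
shadows are unbiased and the kernel of any subsystem S has mean tr(rho_S^2), which is at
most 1. Two consequences bound the moments of the kernel:
- g^2 = 5 + 4 g, so the mean square of the kernel is a sum over S in K of
  5^|K\S| 4^|S| tr(rho_S^2), at most 9^|K|;
- summing g(x,i) g(x,j) over x gives 6 g(i,j) - 2, and the outcome probabilities
  on K are at most 2^-|K|, so the conditional mean of the kernel has mean square
  at most 2^-|K| 6^|K| = 3^|K|.
The variance of the U-statistic is then at most
4 3^|K| / M + 2 9^|K| / (M (M - 1)), and Chebyshev's inequality with a union
bound over the L subsystems concludes. *)

Require Import Defs.
From HB Require Import structures.
From mathcomp Require Import all_boot all_order all_algebra.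
From mathcomp Require Import ring.
Import Order.TTheory GRing.Theory Num.Theory.
Local Open Scope ring_scope.
Set Implicit Arguments. Unset Strict Implicit. Unset Printing Implicit Defensive.

(** * Expectations over independent samples *)

Section Sampling.
Variables (C : numFieldType) (T : finType) (p : T -> C) (M : nat).
Implicit Types (F G : {ffun 'I_M -> T} -> C) (w : {ffun 'I_M -> T}) (m l : 'I_M).
Hypothesis p_ge0 : forall t, 0 <= p t.
Hypothesis p_sum1 : \sum_t p t = 1.

Definition iid_mean F : C := \sum_(w : {ffun 'I_M -> T}) (\prod_m p (w m)) * F w.
Definition update w m t : {ffun 'I_M -> T} := [ffun j => if j == m then t else w j].

Lemma update_same w m t : update w m t m = t.
Proof. by rewrite ffunE eqxx. Qed.

Lemma update_diff w m j t : j != m -> update w m t j = w j.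
Proof. by rewrite ffunE => /negPf ->. Qed.

Lemma iid_weight_ge0 w : 0 <= \prod_m p (w m).
Proof. by apply: prodr_ge0 => m _. Qed.

Lemma iid_weight_sum1 : \sum_(w : {ffun 'I_M -> T}) \prod_m p (w m) = 1.
Proof.
by rewrite -(bigA_distr_bigA (fun _ : 'I_M => p)) big1.
Qed.

Lemma eq_iid_mean F G : F =1 G -> iid_mean F = iid_mean G.
Proof. by move=> eqFG; apply: eq_bigr => w _; rewrite eqFG. Qed.

Lemma iid_mean_cst c : iid_mean (fun=> c) = c.
Proof. by rewrite /iid_mean -mulr_suml iid_weight_sum1 mul1r. Qed.

Lemma iid_mean_sum (I : Type) (r : seq I) (P : pred I) (F : I -> {ffun 'I_M -> T} -> C) :
  iid_mean (fun w => \sum_(i <- r | P i) F i w) = \sum_(i <- r | P i) iid_mean (F i).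
Proof.
by rewrite exchange_big; apply: eq_bigr => w _; rewrite mulr_sumr.
Qed.

Lemma iid_meanZ c F : iid_mean (fun w => c * F w) = c * iid_mean F.
Proof. by rewrite /iid_mean mulr_sumr; apply: eq_bigr => w _; rewrite mulrCA. Qed.

(* The pairs (w, t) and (w with t at m, w m) have the same total weight, so
   redrawing one sample does not change an expectation. *)
Lemma iid_mean_resample m F :
  iid_mean F = iid_mean (fun w => \sum_t p t * F (update w m t)).
Proof.
pose swap (u : {ffun 'I_M -> T} * T) := (update u.1 m u.2, u.1 m).
have swapK : involutive swap.
  case=> w t; congr pair; last by rewrite /= update_same.
  by apply/ffunP=> j; rewrite !ffunE; case: eqP => // ->.
have -> : iid_mean F = \sum_(u : {ffun 'I_M -> T} * T)
    (\prod_j p (u.1 j)) * p u.2 * F u.1.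
  rewrite -(pair_big xpredT xpredT (fun w t => (\prod_j p (w j)) * p t * F w)) /=.
  by apply: eq_bigr => w _; rewrite -!mulr_suml -mulr_sumr p_sum1 mulr1.
rewrite (reindex_inj (inv_inj swapK)) /iid_mean.
under [RHS]eq_bigr => w _ do rewrite mulr_sumr.
rewrite pair_big /=; apply: eq_bigr => -[w t] _ /=; rewrite mulrA; congr (_ * _).
rewrite (bigD1 m) //= [in RHS](bigD1 m) //= update_same.
rewrite (eq_bigr (fun j => p (w j))); first by ring.
by move=> j jm; rewrite update_diff.
Qed.

(** Markov's inequality for the sum of the squares: wherever the event fails, one [X i w] exceeds
    [eps] in modulus and the sum already exceeds [eps ^+ 2], so Chebyshev and the union bound come
    in one step. *)
Lemma iid_chebyshev_union (L : nat) (X : 'I_L -> {ffun 'I_M -> T} -> C) (eps delta : C) :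
  (forall i w, X i w \is Num.real) -> 0 < eps ->
  \sum_i iid_mean (fun w => X i w ^+ 2) <= eps ^+ 2 * delta ->
  1 - delta <= \sum_(w : {ffun 'I_M -> T} | [forall i, `|X i w| <= eps]) \prod_m p (w m).
Proof.
move=> X_real eps_gt0 X_le.
rewrite lerBlDr -[X in X <= _]iid_weight_sum1.
rewrite (bigID (fun w => [forall i, `|X i w| <= eps])) /= lerD2l.
rewrite -(ler_pM2l (exprn_gt0 2 eps_gt0)); apply: le_trans X_le.
rewrite -iid_mean_sum mulr_sumr big_mkcond; apply: ler_sum => w _.
have sqr_ge0 i : 0 <= X i w ^+ 2 by rewrite real_exprn_even_ge0.
case: ifP => [/forallPn[i] | _]; last first.
  by rewrite mulr_ge0 ?iid_weight_ge0 ?sumr_ge0.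
rewrite -real_ltNge ?normr_real ?gtr0_real // => eps_lt.
rewrite mulrC ler_wpM2l ?iid_weight_ge0 // (bigD1 i) //=.
apply: (@le_trans _ _ (X i w ^+ 2)); last by rewrite lerDl sumr_ge0.
by rewrite -(real_normK (X_real i w)) lerXn2r ?nnegrE ?normr_ge0 // ltW.
Qed.

(** * Second moment of a centred U-statistic of order two *)

Section Kernel.
Variable k : T -> T -> C.
Hypothesis k_sym : forall x y, k x y = k y x.
Hypothesis k_mean0 : \sum_x p x * (\sum_y p y * k x y) = 0.
Variables z1 z2 : C.
Let a x := \sum_y p y * k x y.
Hypothesis z1_bound : \sum_x p x * a x ^+ 2 <= z1.
Hypothesis z2_bound : \sum_x p x * (\sum_y p y * k x y ^+ 2) <= z2.

(** When the indices within each pair are distinct, both kernel values have mean zero, so this is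
    their covariance. *)
Definition pair_cov m m' l l' := iid_mean (fun w => k (w m) (w m') * k (w l) (w l')).

Lemma pair_cov_swapl m m' l l' : pair_cov m m' l l' = pair_cov m' m l l'.
Proof. by apply: eq_iid_mean => w; rewrite k_sym. Qed.

Lemma pair_cov_swapr m m' l l' : pair_cov m m' l l' = pair_cov m m' l' l.
Proof. by apply: eq_iid_mean => w; rewrite (k_sym (w l)). Qed.

(** Redrawing [m'] and then [m] averages the first kernel value to zero, because the second does not
    involve these samples. *)
Lemma pair_cov_disjoint m m' l l' :
  m != m' -> l != m -> l' != m -> l != m' -> l' != m' -> pair_cov m m' l l' = 0.
Proof.
move=> mm' lm l'm lm' l'm'.
rewrite /pair_cov (iid_mean_resample m').
under eq_iid_mean => w.
  under eq_bigr => t _ do rewrite update_same !update_diff // mulrA.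
  rewrite -mulr_suml; over.
rewrite (iid_mean_resample m).
under eq_iid_mean => w.
  under eq_bigr => t _ do rewrite update_same !update_diff // mulrA.
  rewrite -mulr_suml k_mean0 mul0r; over.
exact: iid_mean_cst.
Qed.

(** Redrawing the two unshared samples turns each kernel value into the conditional mean [a] at the
    shared sample; what remains is the mean of [a ^+ 2]. *)
Lemma pair_cov_share m m' l' :
  m != m' -> m != l' -> l' != m' -> pair_cov m m' m l' <= z1.
Proof.
move=> mm' ml' l'm'.
rewrite /pair_cov (iid_mean_resample m').
under eq_iid_mean => w.
  under eq_bigr => t _ do rewrite update_same !update_diff // mulrA.
  rewrite -mulr_suml -/(a _); over.
rewrite (iid_mean_resample l').
under eq_iid_mean => w.
  under eq_bigr => t _ do rewrite update_same !update_diff // mulrCA.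
  rewrite -mulr_sumr -/(a _) -expr2; over.
rewrite (iid_mean_resample m).
under eq_iid_mean => w do under eq_bigr => t _ do rewrite update_same.
by rewrite iid_mean_cst.
Qed.

Lemma pair_cov_same m m' : m != m' -> pair_cov m m' m m' <= z2.
Proof.
move=> mm'; rewrite /pair_cov (iid_mean_resample m').
under eq_iid_mean => w do
  under eq_bigr => t _ do rewrite update_same !update_diff // -expr2.
rewrite (iid_mean_resample m).
under eq_iid_mean => w do under eq_bigr => t _ do rewrite update_same.
by rewrite iid_mean_cst.
Qed.

Hypothesis z1_ge0 : 0 <= z1.

(** One bound covers all overlap patterns, so that it can be summed indicator by indicator. When the
    pairs coincide, two of the [z1] indicators also fire; this excess is harmless as [z1] is
    nonnegative. *)
Lemma pair_cov_le m m' l l' : m != m' -> l != l' ->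
  pair_cov m m' l l' <=
    z1 * ((m == l)%:R + (m == l')%:R + (m' == l)%:R + (m' == l')%:R)
    + z2 * ((m == l)%:R * (m' == l')%:R + (m == l')%:R * (m' == l)%:R).
Proof.
move=> mm' ll'.
have simp := (mul1r, mul0r, mulr0, addr0, add0r, mulr1, mulrDr).
have [ml|ml] := eqVneq m l.
  rewrite -ml in ll' *; rewrite [m' == m]eq_sym (negPf mm') (negPf ll').
  have [<-|m'l'] := eqVneq m' l'; rewrite !simp.
    by apply: le_trans (pair_cov_same mm') _; rewrite lerDr addr_ge0.
  by apply: pair_cov_share; rewrite // eq_sym.
have [ml'|ml'] := eqVneq m l'.
  rewrite -ml' in ll' *; rewrite [m' == m]eq_sym (negPf mm') pair_cov_swapr.
  have [<-|m'l] := eqVneq m' l; rewrite !simp.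
    by apply: le_trans (pair_cov_same mm') _; rewrite lerDr addr_ge0.
  by apply: pair_cov_share; rewrite // eq_sym.
have [m'l|m'l] := eqVneq m' l.
  rewrite -m'l in ll' *; rewrite (negPf ll') !simp pair_cov_swapl.
  by apply: pair_cov_share; rewrite // eq_sym.
have [m'l'|m'l'] := eqVneq m' l'; rewrite !simp.
  rewrite -m'l' in ll' *; rewrite pair_cov_swapl pair_cov_swapr.
  by apply: pair_cov_share; rewrite // eq_sym.
by rewrite pair_cov_disjoint // eq_sym.
Qed.

Lemma sum_neq_ord m : \sum_(j | m != j) (1 : C) = M%:R - 1.
Proof.
have -> : M%:R = \sum_(j < M) (1 : C) by rewrite sumr_const card_ord.
rewrite [in RHS](bigD1 m) //= addrAC subrr add0r.
by apply: eq_bigl => j; rewrite eq_sym.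
Qed.

Lemma sum_neq_delta m m' (F : 'I_M -> C) :
  m != m' -> \sum_(j | m != j) (m' == j)%:R * F j = F m'.
Proof.
move=> mm'; rewrite (bigD1 m') //= eqxx mul1r big1 ?addr0 // => j.
by case/andP=> _; rewrite eq_sym => /negPf ->; rewrite mul0r.
Qed.

Lemma ustat_second_moment :
  iid_mean (fun w => (\sum_m \sum_(m' | m != m') k (w m) (w m')) ^+ 2) <=
    4%:R * z1 * M%:R * (M%:R - 1) ^+ 2 + 2%:R * z2 * M%:R * (M%:R - 1).
Proof.
under eq_iid_mean => w.
  rewrite expr2 mulr_suml.
  under eq_bigr => m _.
    rewrite mulr_suml.
    under eq_bigr => m' _.
      rewrite mulr_sumr.
      under eq_bigr => l _ do rewrite mulr_sumr.
      over.
    over.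
  over.
rewrite iid_mean_sum.
under eq_bigr => m _ do rewrite iid_mean_sum.
under eq_bigr => m _ do under eq_bigr => m' _ do rewrite iid_mean_sum.
under eq_bigr => m _ do under eq_bigr => m' _ do under eq_bigr => l _ do rewrite iid_mean_sum.
(* For a fixed pair, each of the four single overlaps occurs for [M - 1] ordered pairs [(l, l')],
   and each of the two coincidences for exactly one. *)
have row m m' : m != m' ->
    \sum_l \sum_(l' | l != l') pair_cov m m' l l' <=
      4%:R * z1 * (M%:R - 1) + 2%:R * z2.
  move=> mm'.
  have sum_l (j : 'I_M) : \sum_l \sum_(l' | l != l') (j == l)%:R = M%:R - 1 :> C.
    rewrite (bigD1 j) //= [X in _ + X]big1 ?addr0; last first.
      by move=> l jl; rewrite big1 // => l' _; rewrite eq_sym (negPf jl).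
    by rewrite -(sum_neq_ord j); apply: eq_bigr => l' _; rewrite eqxx.
  have sum_l' (j : 'I_M) : \sum_l \sum_(l' | l != l') (j == l')%:R = M%:R - 1 :> C.
    rewrite -(sum_l j) (exchange_big_dep xpredT) //=.
    by apply: eq_bigr => l _; apply: eq_bigl => l'; rewrite eq_sym.
  have sum2 (i j : 'I_M) : i != j ->
      \sum_l \sum_(l' | l != l') (i == l)%:R * (j == l')%:R = 1 :> C.
    move=> ij; rewrite (bigD1 i) //= [X in _ + X]big1 ?addr0; last first.
      by move=> l il; rewrite big1 // => l' _; rewrite eq_sym (negPf il) mul0r.
    rewrite -[RHS](sum_neq_delta (fun=> 1) ij); apply: eq_bigr => l' _.
    by rewrite eqxx mul1r mulr1.
  apply: (@le_trans _ _ (\sum_l \sum_(l' | l != l')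
    (z1 * ((m == l)%:R + (m == l')%:R + (m' == l)%:R + (m' == l')%:R)
    + z2 * ((m == l)%:R * (m' == l')%:R + (m' == l)%:R * (m == l')%:R)))).
    apply: ler_sum => l _; apply: ler_sum => l' ll'.
    by rewrite [X in z2 * (_ + X)]mulrC pair_cov_le.
  under eq_bigr => l _ do rewrite big_split /= -!mulr_sumr !big_split /=.
  rewrite big_split /= -!mulr_sumr !big_split /= !sum_l !sum_l' !sum2 //; last by rewrite eq_sym.
  by rewrite le_eqVlt; apply/orP; left; apply/eqP; ring.
apply: (@le_trans _ _ (\sum_m \sum_(m' | m != m') (4%:R * z1 * (M%:R - 1) + 2%:R * z2))).
  by apply: ler_sum => m _; apply: ler_sum => m' mm'; exact: row.
under eq_bigr => m _ do rewrite -[X in \sum_(_ | _) X]mulr1 -mulr_sumr sum_neq_ord.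
rewrite sumr_const card_ord -mulr_natr.
rewrite le_eqVlt; apply/orP; left; apply/eqP; ring.
Qed.

End Kernel.
End Sampling.

(** * Products of sums over finite index sets *)

Section ProductSums.
Variables (R : comPzRingType) (I J : finType).

Lemma prod_eq_indicator (T : eqType) (f g : {ffun I -> T}) :
  \prod_i (f i == g i)%:R = (f == g)%:R :> R.
Proof.
have [->|neq] := eqVneq f g; first by rewrite big1 // => i _; rewrite eqxx.
have [i ne_i] : exists i, f i != g i.
  apply/existsP; apply: contraNT neq; rewrite negb_exists => /forallP eqfg.
  by apply/eqP/ffunP=> i; apply/eqP/negbNE/eqfg.
by rewrite (bigD1 i) //= (negPf ne_i) mul0r.
Qed.

Lemma prodD_subset (K : {set I}) (x y : I -> R) :
  \prod_(i in K) (x i + y i) =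
  \sum_(S : {set I} | S \subset K) (\prod_(i in K :\: S) x i) * \prod_(i in S) y i.
Proof.
(* Extending [y] by 0 and [x] by 1 outside [K] leaves the product unchanged and kills every subset
   not contained in [K]. *)
pose y' i := if i \in K then y i else 0; pose x' i := if i \in K then x i else 1.
transitivity (\prod_i (y' i + x' i)).
  rewrite big_mkcond; apply: eq_bigr => i _; rewrite /x' /y'.
  by case: ifP => _; rewrite ?add0r // addrC.
rewrite bigA_distr [RHS]big_mkcond; apply: eq_bigr => S _.
case: ifP => [/subsetP sSK | /negbT/subsetPn[i iS iK]]; last first.
  by rewrite (bigD1 i) //= iS /y' (negPf iK) mul0r.
rewrite [X in X * _]big_mkcond [X in _ * X]big_mkcond -big_split; apply: eq_bigr => i _ /=.
rewrite inE /x' /y'; case: ifP => [iS | _] /=; first by rewrite sSK ?mul1r.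
by case: ifP; rewrite mulr1.
Qed.

Lemma sum_ffun_prod_in (K : {set I}) (F : I -> J -> R) :
  \sum_(f : {ffun I -> J}) \prod_(i in K) F i (f i) =
  #|J|%:R ^+ #|~: K| * \prod_(i in K) \sum_j F i j.
Proof.
transitivity (\sum_(f : {ffun I -> J}) \prod_i (if i \in K then F i (f i) else 1)).
  by apply: eq_bigr => f _; rewrite big_mkcond.
rewrite -(bigA_distr_bigA (fun i j => if i \in K then F i j else 1)).
rewrite (bigID (mem K)) /= mulrC; congr (_ * _); last first.
  by apply: eq_bigr => i ->.
under eq_bigr => i /negPf -> do rewrite sumr_const.
by rewrite prodr_const; congr (_ ^+ _); apply: eq_card => i; rewrite !inE.
Qed.

End ProductSums.

(** * One qubit: SIC projectors and their dual basis *)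

Section SicTomography.
Variables (C : numClosedFieldType) (psi : 'I_4 -> 'I_2 -> C).
Hypothesis sic_psi : sic psi.

Lemma sum_I2 (F : 'I_2 -> C) : \sum_i F i = F ord0 + F ord_max.
Proof.
by rewrite !big_ord_recl big_ord0 addr0; congr (_ + F _); apply: val_inj.
Qed.

Lemma sic_overlap i j :
  inner (psi i) (psi j) * inner (psi j) (psi i) = if i == j then 1 else 3%:R^-1.
Proof.
have [unit_psi overlap] := sic_psi.
have innerC : inner (psi j) (psi i) = (inner (psi i) (psi j))^*.
  rewrite /inner rmorph_sum; apply: eq_bigr => k _.
  by rewrite rmorphM /= conjCK mulrC.
case: eqP => [<-|/eqP ij]; first by rewrite !unit_psi mulr1.
by rewrite innerC -normCK overlap.
Qed.

Definition shadow1 i (b b' : 'I_2) : C :=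
  3%:R * psi i b * (psi i b')^* - (b == b')%:R.

Definition shadow_kernel (i j : 'I_4) : C := if i == j then 5%:R else -1.

Lemma trace_shadow1 i : \sum_b shadow1 i b b = 1.
Proof.
have := sic_psi.1 i; rewrite /inner /shadow1 !sum_I2 !eqxx /= => /(canRL (addrK _)) e.
ring: e.
Qed.

(** Expanding tr((3 P_i - 1)(3 P_j - 1)) gives 9 |<psi_i|psi_j>|^2 - 3 - 3 + 2, where the squared
    overlap is 1 or 1/3. *)
Lemma shadow1_mul_trace i j :
  \sum_b \sum_b' shadow1 i b b' * shadow1 j b' b = shadow_kernel i j.
Proof.
have := sic_overlap i j; have := sic_psi.1 i; have := sic_psi.1 j.
rewrite /shadow_kernel /inner !sum_I2 /shadow1 /=.
move=> /(canRL (addrK _)) ej /(canRL (addrK _)) ei eij.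
transitivity (if i == j then 9%:R - 4%:R else 9%:R * 3%:R^-1 - 4%:R : C); last first.
  by case: ifP => _; [ring | field].
have -> : (if i == j then 9%:R - 4%:R else 9%:R * 3%:R^-1 - 4%:R : C) =
  9%:R * (if i == j then 1 else 3%:R^-1) - 4%:R by case: ifP; rewrite ?mulr1.
rewrite -eij; ring: ei ej.
Qed.

(* The matrices (3 P_i - 1)/2 are biorthogonal to the four projectors; in the
   4-dimensional space of 2x2 matrices this makes them a basis and its dual. *)
Lemma shadow1_tomography (b b' c c' : 'I_2) :
  \sum_i 2%:R^-1 * ((psi i c)^* * psi i c' * shadow1 i b b') =
  (b == c)%:R * (b' == c')%:R.
Proof.
pose V : 'M[C]_(4, 2 * 2) := \matrix_(i, k)
  (mxvec (\matrix_(x, y) ((psi i x)^* * psi i y)) ord0 k).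
pose W : 'M[C]_(2 * 2, 4) := \matrix_(k, i)
  (2%:R^-1 * mxvec (\matrix_(x, y) shadow1 i x y) ord0 k).
(* Entry [(i, j)] is the trace of P_i (3 P_j - 1)/2, that is (3 |<psi_i|psi_j>|^2 - 1)/2. *)
have VW1 : V *m W = 1%:M.
  apply/matrixP=> i j; rewrite !mxE.
  rewrite (reindex (uncurry (@mxvec_index 2 2))) /=; last first.
    exact: curry_mxvec_bij.
  transitivity (\sum_x \sum_y V i (mxvec_index x y) * W (mxvec_index x y) j).
    by rewrite pair_big; apply: eq_bigr => -[].
  under eq_bigr => x _ do under eq_bigr => y _ do rewrite !mxE !mxvecE !mxE.
  have := sic_overlap i j; have := sic_psi.1 i; have := sic_psi.1 j.
  rewrite /inner !sum_I2 /shadow1 /= => /(canRL (addrK _)) ej /(canRL (addrK _)) ei eij.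
  transitivity (2%:R^-1 * (3%:R * (if i == j then 1 else 3%:R^-1) - 1) : C); last first.
    by case: (i == j) => /=; field.
  rewrite -eij; ring: ei.
(* Both factors are square of size 4, so [W *m V] is the identity too, and its entries are the
   claim. *)
have := congr1 (fun A : 'M_(2 * 2) => A (mxvec_index b b') (mxvec_index c c')) (mulmx1C VW1).
rewrite !mxE.
under eq_bigr => i _ do rewrite !mxE !mxvecE !mxE -mulrA [shadow1 _ _ _ * _]mulrC.
move=> ->; have mxvec_inj : injective (uncurry (@mxvec_index 2 2)).
  by case: (curry_mxvec_bij 2 2) => g gK _ x y e; rewrite -(gK x) // e gK.
by rewrite -natrM mulnb (inj_eq mxvec_inj (b, b') (c, c')) xpair_eqE.
Qed.

(** Set [b' = b] in the tomography identity and sum over [b]: each [shadow1] has trace one. This is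
    the POVM condition, derived from the overlaps. *)
Lemma sic_resolution (c c' : 'I_2) :
  \sum_i 2%:R^-1 * ((psi i c)^* * psi i c') = (c == c')%:R.
Proof.
transitivity (\sum_b (b == c)%:R * (b == c')%:R : C).
  under [RHS]eq_bigr => b _ do rewrite -shadow1_tomography.
  rewrite exchange_big; apply: eq_bigr => i _ /=.
  by rewrite -!mulr_sumr trace_shadow1 mulr1.
rewrite (bigD1 c) //= eqxx mul1r big1 ?addr0 // => b /negPf ->.
by rewrite mul0r.
Qed.

End SicTomography.

(** * Positive operators, partial traces and product operators *)

Section Positivity.
Variables (C : numClosedFieldType) (N : nat).
Implicit Types (A : op C N) (b c : config N).

(** [f] need not be injective: coefficients with the same image under [f] are added up to form one
    test vector for [A]. *)
Lemma psd_form_ge0 A (J : finType) (f : J -> config N) (v : J -> C) :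
  psd A -> 0 <= \sum_i \sum_j (v i)^* * A (f i) (f j) * v j.
Proof.
case=> _ /(_ (fun x => \sum_(i | f i == x) v i)).
rewrite [X in 0 <= X -> _](_ : _ = \sum_i \sum_j (v i)^* * A (f i) (f j) * v j) //.
rewrite [RHS](partition_big f xpredT) //=; apply: eq_bigr => x _.
under [LHS]eq_bigr => y _ do rewrite rmorph_sum /= -mulrA mulr_suml.
rewrite exchange_big; apply: eq_bigr => i /eqP <- /=.
rewrite [RHS](partition_big f xpredT) //=; apply: eq_bigr => y _.
by rewrite !mulr_sumr; apply: eq_bigr => j /eqP <-; rewrite mulrA.
Qed.

Lemma psd_diag_ge0 A b : psd A -> 0 <= A b b.
Proof.
move=> /(@psd_form_ge0 A 'I_1 (fun=> b) (fun=> 1)).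
by rewrite !big_ord1 rmorph1 mul1r mulr1.
Qed.

(** The quadratic form with coefficient [- A b c] at [b] and a real [s] at [c] is a real polynomial
    in [s]; its nonnegativity for all [s] gives the minor. *)
Lemma psd_minor A b c : psd A -> A b c * A c b <= A b b * A c c.
Proof.
move=> psdA; have herm := psdA.1 b c.
have a_ge0 := psd_diag_ge0 b psdA; have d_ge0 := psd_diag_ge0 c psdA.
have form s : s \is Num.real ->
    0 <= A b c * A c b * A b b - 2%:R * s * (A b c * A c b) + s ^+ 2 * A c c.
  move=> s_real.
  have := @psd_form_ge0 A 'I_2 (fun i => if i == ord0 then b else c)
    (fun i => if i == ord0 then - A b c else s) psdA.
  rewrite !sum_I2 /= rmorphN /= -herm (CrealP s_real) => /le_trans; apply.
  by rewrite le_eqVlt; apply/orP; left; apply/eqP; ring.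
have z_ge0 : 0 <= A b c * A c b by rewrite herm -normCK exprn_ge0.
move: (A b c * A c b) (A b b) (A c c) z_ge0 a_ge0 d_ge0 form => z a d z_ge0 a_ge0 d_ge0 form.
(* With [d = 0] the polynomial is [z * (a - 2 * s)], and any [s] above [a / 2], such as [a + 1],
   forces [z] to be at most 0. *)
have [d0|d_neq0] := eqVneq d 0.
  have := form (a + 1) (ger0_real (addr_ge0 a_ge0 ler01)).
  rewrite d0 !mulr0 addr0 (_ : _ - _ = - ((a + 2%:R) * z)); last by ring.
  by rewrite oppr_ge0 pmulr_rle0 // ltr_wpDl.
have d_gt0 : 0 < d by rewrite lt_def d_neq0.
have [->|z_neq0] := eqVneq z 0; first exact: mulr_ge0.
have z_gt0 : 0 < z by rewrite lt_def z_neq0.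
(* [z / d] minimises the polynomial in [s]. *)
have := form (z / d) (ger0_real (divr_ge0 z_ge0 d_ge0)).
rewrite (_ : _ + _ = z / d * (a * d - z)); last by field.
by rewrite pmulr_rge0 ?divr_gt0 // subr_ge0.
Qed.

Lemma trace_sqr_le A : psd A -> trace (opmul A A) <= trace A ^+ 2.
Proof.
move=> psdA; rewrite expr2 mulr_suml; apply: ler_sum => b _.
by rewrite mulr_sumr; apply: ler_sum => c _; exact: psd_minor.
Qed.

Lemma psd_ptrace (K : {set 'I_N}) A : psd A -> psd (ptrace K A).
Proof.
move=> psdA; split=> [b b'|v].
  rewrite /ptrace andbC; case: ifP => _; last by rewrite rmorph0.
  by rewrite rmorph_sum; apply: eq_bigr => c _; exact: psdA.1.
(* Unsupported strings get weight zero, as in [ptrace]; the form then splits over environment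
   strings [c] into pullbacks of the form of [A] along [merge]. *)
pose v' b := if supported K b then v b else 0.
have -> : \sum_b \sum_b' (v b)^* * ptrace K A b b' * v b' =
    \sum_(c | supported (~: K) c)
      \sum_b \sum_b' (v' b)^* * A (Defs.merge K b c) (Defs.merge K b' c) * v' b'.
  rewrite [RHS]exchange_big; apply: eq_bigr => b _ /=.
  rewrite [RHS]exchange_big; apply: eq_bigr => b' _ /=.
  rewrite /v' /ptrace; case: (supported K b) => /=; last first.
    by rewrite mulr0 mul0r big1 // => c _; rewrite rmorph0 !mul0r.
  case: (supported K b'); last first.
    by rewrite mulr0 mul0r big1 // => c _; rewrite mulr0.
  by rewrite mulr_sumr mulr_suml.
by apply: sumr_ge0 => c _; exact: psd_form_ge0.
Qed.

(** A supported string is a function on [K] padded with the default [ord0], which is the index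
    family of the general distributive law. *)
Lemma sum_supported_prod (K : {set 'I_N}) (F : 'I_N -> 'I_2 -> C) :
  \sum_(b : config N | supported K b) \prod_(n in K) F n (b n) =
  \prod_(n in K) \sum_k F n k.
Proof.
rewrite (big_distr_big ord0); apply: eq_bigl => b.
apply/forallP/pffun_onP => [supp|[/supportP supp _] n]; last first.
  by apply/implyP=> nK; apply/eqP/supp.
split=> //; apply/supportP=> n nK.
by have /implyP/(_ nK)/eqP := supp n.
Qed.

Lemma sum_merge (K : {set 'I_N}) (F : config N -> C) :
  \sum_(b | supported K b) \sum_(c | supported (~: K) c) F (Defs.merge K b c) = \sum_b F b.
Proof.
pose z : config N := [ffun=> ord0].
rewrite pair_big_dep /= (reindex (fun b => (Defs.merge K b z, Defs.merge K z b))) /=.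
  apply: eq_big => [b|b _].
    by apply/andP; split; apply/forallP=> n; apply/implyP; rewrite !ffunE ?inE; case: (n \in K).
  by congr F; apply/ffunP=> n; rewrite !ffunE; case: (n \in K).
exists (fun u => Defs.merge K u.1 u.2) => [b _ | [b c] /andP[/forallP sb /forallP sc]] /=.
  by apply/ffunP=> n; rewrite !ffunE; case: (n \in K).
congr pair; apply/ffunP=> n; rewrite !ffunE.
  by case nK: (n \in K) => //; have := sb n; rewrite nK => /eqP ->.
by case nK: (n \in K) => //; have := sc n; rewrite inE nK => /eqP ->.
Qed.

Lemma trace_ptrace (K : {set 'I_N}) A : trace (ptrace K A) = trace A.
Proof.
rewrite /trace -[RHS](sum_merge K) [RHS]big_mkcond; apply: eq_bigr => b _.
by rewrite /ptrace andbb.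
Qed.

Lemma purity_le1 (K : {set 'I_N}) (rho : op C N) : density rho -> purity K rho <= 1.
Proof.
case=> psd_rho tr1; apply: le_trans (trace_sqr_le (psd_ptrace K psd_rho)) _.
by rewrite trace_ptrace tr1 expr1n.
Qed.

(** Each traced-out site contributes its trace, which is 1. *)
Lemma ptrace_prod (K : {set 'I_N}) (s : 'I_N -> 'I_2 -> 'I_2 -> C) b b' :
  (forall n, \sum_k s n k k = 1) ->
  ptrace K (fun x y => \prod_n s n (x n) (y n)) b b' =
  (supported K b && supported K b')%:R * \prod_(n in K) s n (b n) (b' n).
Proof.
move=> tr1; rewrite /ptrace; case: ifP => _; last by rewrite mul0r.
rewrite mul1r; transitivity (\sum_(c | supported (~: K) c)
    (\prod_(n in K) s n (b n) (b' n)) * \prod_(n in ~: K) s n (c n) (c n)).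
  apply: eq_bigr => c _; rewrite (bigID (mem K)) /=; congr (_ * _).
    by apply: eq_bigr => n nK; rewrite !ffunE nK.
  apply: eq_big => [n|n /negPf nK]; first by rewrite inE.
  by rewrite !ffunE nK.
rewrite -mulr_sumr (sum_supported_prod (~: K) (fun n k => s n k k)).
by rewrite [X in _ * X]big1 ?mulr1.
Qed.

Lemma trace_opmul_ptrace_prod (K : {set 'I_N}) (s t : 'I_N -> 'I_2 -> 'I_2 -> C) :
  (forall n, \sum_k s n k k = 1) -> (forall n, \sum_k t n k k = 1) ->
  trace (opmul (ptrace K (fun x y => \prod_n s n (x n) (y n)))
               (ptrace K (fun x y => \prod_n t n (x n) (y n)))) =
  \prod_(n in K) \sum_k \sum_k' s n k k' * t n k' k.
Proof.
move=> trs trt;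
transitivity (\sum_(b | supported K b) \sum_(b' | supported K b')
    \prod_(n in K) (s n (b n) (b' n) * t n (b' n) (b n))).
  rewrite /trace /opmul [RHS]big_mkcond; apply: eq_bigr => b _.
  case: ifPn => sb; last first.
    by rewrite big1 // => b' _; rewrite !ptrace_prod // (negPf sb) !mul0r.
  rewrite [RHS]big_mkcond; apply: eq_bigr => b' _.
  rewrite !ptrace_prod // sb /= andbT; case: ifP => _; last by rewrite !mul0r.
  by rewrite !mul1r big_split.
rewrite -(sum_supported_prod K (fun n k => \sum_k' s n k k' * t n k' k)).
apply: eq_bigr => b _.
exact: (sum_supported_prod K (fun n k' => s n (b n) k' * t n k' (b n))).
Qed.

End Positivity.

(** * Outcome distribution and moments of the purity kernel *)

Section ShadowMoments.
Variables (C : numClosedFieldType) (N : nat) (rho : op C N) (psi : 'I_4 -> 'I_2 -> C).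
Implicit Types (K : {set 'I_N}) (o : outcome N).

(** The vectors [u n i] are arbitrary, so the factorisation serves both the SIC measurement and a
    product of orthonormal bases. *)
Lemma born_sum_prod (I : finType) (u : 'I_N -> I -> 'I_2 -> C) (F : 'I_N -> I -> C) :
  \sum_(s : {ffun 'I_N -> I})
    (\sum_(b : config N) \sum_(b' : config N)
       (\prod_n u n (s n) (b n))^* * rho b b' * \prod_n u n (s n) (b' n))
    * \prod_n F n (s n) =
  \sum_b \sum_b' rho b b' * \prod_n \sum_i (u n i (b n))^* * u n i (b' n) * F n i.
Proof.
under eq_bigr => s _ do rewrite mulr_suml.
rewrite exchange_big; apply: eq_bigr => b _ /=.
under eq_bigr => s _ do rewrite mulr_suml.
rewrite exchange_big; apply: eq_bigr => b' _ /=.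
rewrite bigA_distr_bigA mulr_sumr; apply: eq_bigr => s _.
by rewrite !big_split /= rmorph_prod; ring.
Qed.

Local Notation prob := (outcome_prob psi rho).

Lemma outcome_sum_prod (F : 'I_N -> 'I_4 -> C) :
  \sum_o prob o * \prod_n F n (o n) =
  \sum_b \sum_b' rho b b' *
    \prod_n \sum_i 2%:R^-1 * ((psi i (b n))^* * psi i (b' n) * F n i).
Proof.
transitivity (\sum_(o : outcome N)
   (\sum_(b : config N) \sum_(b' : config N) (prodvec psi o b)^* * rho b b' * prodvec psi o b')
   * \prod_n (2%:R^-1 * F n (o n))).
  apply: eq_bigr => o _; rewrite big_split /= prodr_const card_ord exprVn.
  by rewrite /outcome_prob; ring.
rewrite (born_sum_prod (fun=> psi) (fun n i => 2%:R^-1 * F n i)).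
apply: eq_bigr => b _; apply: eq_bigr => b' _; congr (_ * _).
by apply: eq_bigr => n _; apply: eq_bigr => i _; rewrite mulrCA.
Qed.

Hypothesis rho_density : density rho.
Hypothesis sic_psi : sic psi.

Lemma sum_density_diag : \sum_b \sum_b' rho b b' * (b == b')%:R = 1.
Proof.
rewrite -[RHS](rho_density.2); apply: eq_bigr => b _.
rewrite (bigD1 b) //= eqxx mulr1 big1 ?addr0 // => b' /negPf.
by rewrite eq_sym => ->; rewrite mulr0.
Qed.

Lemma outcome_prob_ge0 o : 0 <= prob o.
Proof. by rewrite mulr_ge0 ?invr_ge0 ?exprn_ge0 ?ler0n //; case: rho_density => -[_ ->]. Qed.

Lemma outcome_prob_sum1 : \sum_o prob o = 1.
Proof.
transitivity (\sum_o prob o * \prod_(n < N) (1 : C)).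
  by apply: eq_bigr => o _; rewrite big1 ?mulr1.
rewrite (outcome_sum_prod (fun _ _ => 1)) -[RHS]sum_density_diag.
apply: eq_bigr => b _; apply: eq_bigr => b' _; congr (_ * _).
rewrite -prod_eq_indicator; apply: eq_bigr => n _.
by rewrite -(sic_resolution sic_psi); apply: eq_bigr => i _; rewrite mulr1.
Qed.

Lemma shadow_mean b b' : \sum_o prob o * shadow psi o b b' = rho b b'.
Proof.
rewrite (outcome_sum_prod (fun n i => shadow1 psi i (b n) (b' n))).
transitivity (\sum_c \sum_c' rho c c' * ((b == c)%:R * (b' == c')%:R)).
  apply: eq_bigr => c _; apply: eq_bigr => c' _; congr (_ * _).
  rewrite -!prod_eq_indicator -big_split; apply: eq_bigr => n _ /=.
  exact: shadow1_tomography.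
rewrite (bigD1 b) //= eqxx [X in _ + X]big1 ?addr0; last first.
  by move=> c; rewrite eq_sym => /negPf ->; rewrite big1 // => c' _; rewrite mul0r mulr0.
rewrite (bigD1 b') //= eqxx !mulr1 big1 ?addr0 // => c'.
by rewrite eq_sym => /negPf ->; rewrite !mulr0.
Qed.

Definition outcome_kernel K o o' : C := \prod_(n in K) shadow_kernel C (o n) (o' n).

Lemma outcome_kernel_real K o o' : outcome_kernel K o o' \is Num.real.
Proof.
apply: rpred_prod => n _; rewrite /shadow_kernel.
by case: ifP => _; rewrite ?rpredN ?rpred1 ?realn.
Qed.

Lemma outcome_kernel_sym K o o' : outcome_kernel K o o' = outcome_kernel K o' o.
Proof. by apply: eq_bigr => n _; rewrite /shadow_kernel eq_sym. Qed.

Lemma trace_shadow_mul K o o' :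
  trace (opmul (ptrace K (shadow psi o)) (ptrace K (shadow psi o'))) = outcome_kernel K o o'.
Proof.
rewrite (trace_opmul_ptrace_prod K (s := fun n => shadow1 psi (o n))
  (t := fun n => shadow1 psi (o' n))) => [|n|n]; try exact: trace_shadow1.
by apply: eq_bigr => n _; exact: shadow1_mul_trace.
Qed.

Lemma ptrace_shadow_mean K b b' :
  ptrace K rho b b' = \sum_o prob o * ptrace K (shadow psi o) b b'.
Proof.
rewrite /ptrace; case: ifP => _; last by rewrite big1 // => o _; rewrite mulr0.
under [RHS]eq_bigr => o _ do rewrite mulr_sumr.
by rewrite exchange_big; apply: eq_bigr => c _; rewrite shadow_mean.
Qed.

(** By bilinearity the two independent outcomes are averaged separately, and each average of reduced
    shadows is [ptrace K rho]. *)
Lemma outcome_kernel_mean K :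
  \sum_o prob o * (\sum_o' prob o' * outcome_kernel K o o') = purity K rho.
Proof.
rewrite /purity /trace /opmul.
transitivity (\sum_o \sum_o' \sum_b \sum_c (prob o * ptrace K (shadow psi o) b c)
   * (prob o' * ptrace K (shadow psi o') c b)).
  apply: eq_bigr => o _; rewrite mulr_sumr; apply: eq_bigr => o' _.
  rewrite -trace_shadow_mul mulrA /trace mulr_sumr; apply: eq_bigr => b _.
  by rewrite /opmul mulr_sumr; apply: eq_bigr => c _; rewrite mulrACA.
under eq_bigr => o _ do rewrite exchange_big.
rewrite exchange_big; apply: eq_bigr => b _ /=.
under eq_bigr => o _ do rewrite exchange_big.
rewrite exchange_big; apply: eq_bigr => c _ /=.
rewrite !ptrace_shadow_mean mulr_suml; apply: eq_bigr => o _.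
by rewrite mulr_sumr.
Qed.

Lemma outcome_kernel_sqr_mean_le K :
  \sum_o prob o * (\sum_o' prob o' * outcome_kernel K o o' ^+ 2) <= 9%:R ^+ #|K|.
Proof.
have sqr_kernel o o' : outcome_kernel K o o' ^+ 2 = \sum_(S : {set 'I_N} | S \subset K)
    (5%:R ^+ #|K :\: S| * 4%:R ^+ #|S|) * outcome_kernel S o o'.
  rewrite /outcome_kernel -prodrXl.
  transitivity (\prod_(n in K) (5%:R + 4%:R * shadow_kernel C (o n) (o' n))).
    by apply: eq_bigr => n _; rewrite /shadow_kernel; case: eqP => _; ring.
  rewrite prodD_subset; apply: eq_bigr => S _.
  by rewrite big_split /= !prodr_const mulrA.
(* Expanding (5 + 4)^|K| over the same subsets permits a termwise comparison, in which each kernel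
   mean is a purity, at most 1. *)
have -> : 9%:R ^+ #|K| = \sum_(S : {set 'I_N} | S \subset K)
    5%:R ^+ #|K :\: S| * 4%:R ^+ #|S| :> C.
  transitivity (\prod_(n in K) (5%:R + 4%:R) : C).
    by rewrite prodr_const -natrD.
  by rewrite prodD_subset; apply: eq_bigr => S _; rewrite !prodr_const.
under eq_bigr => o _ do under eq_bigr => o' _ do rewrite sqr_kernel mulr_sumr.
under eq_bigr => o _ do rewrite exchange_big mulr_sumr.
rewrite exchange_big; apply: ler_sum => S _ /=.
under eq_bigr => o _ do under eq_bigr => o' _ do rewrite mulrCA.
under eq_bigr => o _ do rewrite -mulr_sumr mulrCA.
by rewrite -mulr_sumr outcome_kernel_mean ler_piMr ?mulr_ge0 ?exprn_ge0 ?ler0n ?purity_le1.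
Qed.

(** For a unit vector [v], the second vector of an orthonormal basis. *)
Definition perp (v : 'I_2 -> C) (k : 'I_2) : C :=
  if k == ord0 then (v ord_max)^* else - (v ord0)^*.

Lemma perp_resolution (v : 'I_2 -> C) (k k' : 'I_2) : inner v v = 1 ->
  (v k)^* * v k' + (perp v k)^* * perp v k' = (k == k')%:R.
Proof.
rewrite /inner sum_I2 /perp => v1.
have I2P (i : 'I_2) : i = ord0 \/ i = ord_max.
  by case: (unliftP ord0 i) => [j ->|->]; [right; apply/val_inj; case: j => -[]|left].
by case: (I2P k) => ->; case: (I2P k') => ->; rewrite /= ?rmorphN /= ?conjCK -?v1 /=; ring.
Qed.

(* Complete psi_(o n) to an orthonormal basis at every site: the marginal
   probability is 2^-|K| times a sum over part of an orthonormal product basis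
   of the diagonal entries of rho. *)
Lemma outcome_marginal_le K o :
  \sum_o' prob o' * \prod_(n in K) (o n == o' n)%:R <= 2%:R^-1 ^+ #|K|.
Proof.
pose F n i : C := if n \in K then (o n == i)%:R else 1.
pose u n (a : bool) := if a then psi (o n) else perp (psi (o n)).
pose D (s : {ffun 'I_N -> bool}) := \sum_(b : config N) \sum_(b' : config N)
  (\prod_n u n (s n) (b n))^* * rho b b' * \prod_n u n (s n) (b' n).
pose G n (a : bool) : C := if n \in K then a%:R else 1.
have D_ge0 s : 0 <= D s by case: rho_density => -[_ +] _; apply.
have basis n b b' : \sum_a (u n a b)^* * u n a b' = (b == b')%:R.
  by rewrite big_bool /= perp_resolution // sic_psi.1.
have D_sum1 : \sum_s D s = 1.
  transitivity (\sum_s D s * \prod_(n < N) (1 : C)).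
    by apply: eq_bigr => s _; rewrite big1 ?mulr1.
  rewrite (born_sum_prod u (fun _ _ => 1)) -[RHS]sum_density_diag.
  apply: eq_bigr => b _; apply: eq_bigr => b' _; congr (_ * _).
  rewrite -prod_eq_indicator; apply: eq_bigr => n _.
  by rewrite -(basis n); apply: eq_bigr => a _; rewrite mulr1.
have -> : \sum_o' prob o' * \prod_(n in K) (o n == o' n)%:R =
    2%:R^-1 ^+ #|K| * \sum_s D s * \prod_n G n (s n).
  transitivity (\sum_o' prob o' * \prod_n F n (o' n)).
    by apply: eq_bigr => o' _; rewrite big_mkcond.
  rewrite outcome_sum_prod (born_sum_prod u G) mulr_sumr.
  apply: eq_bigr => b _; rewrite mulr_sumr; apply: eq_bigr => b' _.
  rewrite mulrCA; congr (_ * _).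
  rewrite -prodr_const [X in X * _]big_mkcond -big_split; apply: eq_bigr => n _ /=.
  (* On [K] only the outcome [o n] survives, with its factor 1/2; outside [K] the SIC sum and the
     orthonormal basis both resolve the identity. *)
  rewrite /F /G; case: ifP => _.
    rewrite big_bool /= mulr0 addr0 mulr1 (bigD1 (o n)) //= eqxx mulr1 big1 ?addr0 // => i.
    by rewrite eq_sym => /negPf ->; rewrite !mulr0.
  under eq_bigr => i _ do rewrite mulr1.
  by under [in RHS]eq_bigr => a _ do rewrite mulr1; rewrite sic_resolution // basis mul1r.
rewrite ler_piMr ?exprn_ge0 ?invr_ge0 ?ler0n // -[X in _ <= X]D_sum1.
apply: ler_sum => s _; apply: ler_piMr; first exact: D_ge0.
apply: prodr_ile1 => n _.
by rewrite /G; case: ifP; case: (s n); rewrite ?ler01 ?lexx.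
Qed.

(** With g = 6 delta - 1 a site of [K] sums to 36 delta - 12 + 4 = 6 g - 2; each site outside [K] is
    a free choice among four outcomes. *)
Lemma outcome_kernel_gram_sum K o o' :
  \sum_(x : outcome N) outcome_kernel K x o * outcome_kernel K x o' =
  4%:R ^+ #|~: K| * \prod_(n in K) (6%:R * shadow_kernel C (o n) (o' n) - 2%:R).
Proof.
transitivity (\sum_(x : outcome N) \prod_(n in K)
    (shadow_kernel C (x n) (o n) * shadow_kernel C (x n) (o' n))).
  by apply: eq_bigr => x _; rewrite big_split.
rewrite (sum_ffun_prod_in _ (fun n i => shadow_kernel C i (o n) * shadow_kernel C i (o' n))).
rewrite card_ord; congr (_ * _); apply: eq_bigr => n _.
have gE i j : shadow_kernel C i j = 6%:R * (i == j)%:R - 1.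
  by rewrite /shadow_kernel; case: eqP => _ /=; ring.
have sum_delta (F : 'I_4 -> C) j : \sum_i (i == j)%:R * F i = F j.
  by rewrite (bigD1 j) //= eqxx mul1r big1 ?addr0 // => i /negPf ->; rewrite mul0r.
transitivity (36%:R * (\sum_i (i == o n)%:R * (i == o' n)%:R)
    - 6%:R * (\sum_i (i == o n)%:R * 1) - 6%:R * (\sum_i (i == o' n)%:R * 1)
    + \sum_(i < 4) 1 : C).
  rewrite !mulr_sumr -!sumrB -big_split; apply: eq_bigr => i _ /=.
  by rewrite !gE; ring.
rewrite !sum_delta sumr_const card_ord gE; ring.
Qed.

(** The conditional mean of the kernel given one outcome: its Hoeffding projection before
    centring. *)
Definition kernel_mean K o : C := \sum_o' prob o' * outcome_kernel K o o'.

Lemma kernel_mean_real K o : kernel_mean K o \is Num.real.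
Proof.
apply: rpred_sum => o' _; apply: rpredM; last exact: outcome_kernel_real.
exact/ger0_real/outcome_prob_ge0.
Qed.

(* Since 6 g = (6 g - 2) + 2 and the kernels built from 6 g - 2 are Gram
   matrices, dropping all other terms of the expansion of the product of
   the 6 g bounds the product of the 6 g - 2. *)
Lemma kernel_mean_sqr_sum_le K :
  \sum_o kernel_mean K o ^+ 2 <= 4%:R ^+ #|~: K| * 6%:R ^+ #|K|.
Proof.
pose A (S : {set 'I_N}) o o' : C := \prod_(n in S) (6%:R * shadow_kernel C (o n) (o' n) - 2%:R).
have gram S : \sum_o kernel_mean S o ^+ 2 =
    4%:R ^+ #|~: S| * \sum_o prob o * \sum_o' prob o' * A S o o'.
  transitivity (\sum_o \sum_o' prob o * prob o' *
      \sum_x outcome_kernel S x o * outcome_kernel S x o'); last first.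
    rewrite mulr_sumr; apply: eq_bigr => o _; rewrite !mulr_sumr; apply: eq_bigr => o' _.
    by rewrite outcome_kernel_gram_sum -/(A S o o'); ring.
  under [RHS]eq_bigr => o _ do under eq_bigr => o' _ do rewrite mulr_sumr.
  under [RHS]eq_bigr => o _ do rewrite exchange_big.
  rewrite [RHS]exchange_big; apply: eq_bigr => x _.
  rewrite expr2 mulr_suml; apply: eq_bigr => o _; rewrite mulr_sumr.
  by apply: eq_bigr => o' _; rewrite mulrACA.
(* By [gram], a positive multiple of this number is a sum of squares of reals. *)
have A_ge0 S : 0 <= \sum_o prob o * \sum_o' prob o' * A S o o'.
  rewrite -(@pmulr_rge0 _ (4%:R ^+ #|~: S|)) ?exprn_gt0 ?ltr0n // -gram.
  by apply: sumr_ge0 => o _; rewrite real_exprn_even_ge0 ?kernel_mean_real.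
rewrite gram ler_pM2l ?exprn_gt0 ?ltr0n //.
apply: (@le_trans _ _ (6%:R ^+ #|K| * purity K rho)); last first.
  by rewrite ler_piMr ?exprn_ge0 ?ler0n ?purity_le1.
have -> : 6%:R ^+ #|K| * purity K rho = \sum_(S : {set 'I_N} | S \subset K)
    2%:R ^+ #|K :\: S| * \sum_o prob o * \sum_o' prob o' * A S o o'.
  rewrite -outcome_kernel_mean mulr_sumr.
  under [RHS]eq_bigr => S _ do rewrite mulr_sumr.
  rewrite [RHS]exchange_big; apply: eq_bigr => o _.
  rewrite mulrCA mulr_sumr; under [RHS]eq_bigr => S _ do rewrite mulrCA.
  rewrite -[RHS]mulr_sumr; congr (_ * _).
  under [RHS]eq_bigr => S _ do rewrite mulr_sumr.
  rewrite [RHS]exchange_big; apply: eq_bigr => o' _.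
  rewrite mulrCA; under [RHS]eq_bigr => S _ do rewrite mulrCA.
  rewrite -[RHS]mulr_sumr; congr (_ * _).
  rewrite -prodr_const -big_split /=.
  transitivity (\prod_(n in K) (2%:R + (6%:R * shadow_kernel C (o n) (o' n) - 2%:R))).
    by apply: eq_bigr => n _; ring.
  by rewrite prodD_subset; apply: eq_bigr => S _; rewrite prodr_const.
rewrite (bigD1 K) //= setDv cards0 expr0 mul1r lerDl.
by apply: sumr_ge0 => S _; rewrite mulr_ge0 ?exprn_ge0 ?ler0n.
Qed.

(** [kernel_mean K o] sees only the part of [o] on [K], so [prob] may be replaced by its marginal,
    whose bound leaves an unweighted sum of squares. *)
Lemma kernel_mean_sqr_mean_le K : \sum_o prob o * kernel_mean K o ^+ 2 <= 3%:R ^+ #|K|.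
Proof.
have c_gt0 : 0 < 4%:R ^+ #|~: K| :> C by rewrite exprn_gt0 ?ltr0n.
rewrite -(ler_pM2l c_gt0).
(* The probability of agreeing with [o] on [K]. Each pattern on [K] is shared by 4^|~K| outcomes,
   hence that factor when [q] replaces [prob]. *)
pose q o := \sum_o' prob o' * \prod_(n in K) (o n == o' n)%:R.
have -> : 4%:R ^+ #|~: K| * (\sum_o prob o * kernel_mean K o ^+ 2) =
    \sum_o q o * kernel_mean K o ^+ 2.
  under [RHS]eq_bigr => o _ do rewrite mulr_suml.
  rewrite [RHS]exchange_big mulr_sumr; apply: eq_bigr => o' _ /=.
  have agree o : (\prod_(n in K) (o n == o' n)%:R) * kernel_mean K o ^+ 2 =
      (\prod_(n in K) (o n == o' n)%:R) * kernel_mean K o' ^+ 2.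
    have [/forallP eqK | /forallPn[n]] := boolP [forall n, (n \in K) ==> (o n == o' n)].
      congr (_ * _ ^+ 2); apply: eq_bigr => y _; congr (_ * _); apply: eq_bigr => n nK.
      by have /implyP/(_ nK)/eqP -> := eqK n.
    by rewrite negb_imply => /andP[nK /negPf ne]; rewrite (bigD1 n) //= ne !mul0r.
  under [RHS]eq_bigr => o _ do rewrite -mulrA agree mulrA.
  rewrite -mulr_suml -mulr_sumr.
  rewrite (sum_ffun_prod_in _ (fun n i => (i == o' n)%:R)) card_ord.
  rewrite (_ : \prod_(n in K) _ = 1); first by rewrite mulr1; ring.
  apply: big1 => n _; rewrite (bigD1 (o' n)) //= eqxx big1 ?addr0 //.
  by move=> i /negPf ->.
apply: (@le_trans _ _ (2%:R^-1 ^+ #|K| * \sum_o kernel_mean K o ^+ 2)).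
  rewrite mulr_sumr; apply: ler_sum => o _; apply: ler_wpM2r.
    by rewrite real_exprn_even_ge0 ?kernel_mean_real.
  exact: outcome_marginal_le.
apply: (@le_trans _ _ (2%:R^-1 ^+ #|K| * (4%:R ^+ #|~: K| * 6%:R ^+ #|K|))).
  by rewrite ler_wpM2l ?kernel_mean_sqr_sum_le ?exprn_ge0 ?invr_ge0 ?ler0n.
rewrite mulrCA -exprMn le_eqVlt; apply/orP; left; apply/eqP; congr (_ * _ ^+ _).
by field.
Qed.

End ShadowMoments.

(** * The estimator as a U-statistic, and its variance *)

Lemma sum_neq_sum_lt (R : pzSemiRingType) (M : nat) (F : 'I_M -> 'I_M -> R) :
  (forall i j, F i j = F j i) ->
  \sum_i \sum_(j | i != j) F i j = 2%:R * \sum_(i < M) \sum_(j < M | (i < j)%N) F i j.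
Proof.
move=> F_sym; rewrite mulr_natl mulr2n.
rewrite [X in _ = _ + X](exchange_big_dep xpredT) //= -big_split; apply: eq_bigr => i _ /=.
rewrite (bigID (fun j : 'I_M => (i < j)%N)) /=; congr (_ + _).
  by apply: eq_bigl => j; rewrite -val_eqE /=; case: ltngtP.
apply: eq_big => [j|j _]; last exact: F_sym.
by rewrite -val_eqE /=; case: ltngtP.
Qed.

Section PurityEstimator.
Variables (C : numClosedFieldType) (N : nat) (rho : op C N) (psi : 'I_4 -> 'I_2 -> C).
Hypothesis rho_density : density rho.
Hypothesis sic_psi : sic psi.
Variables (M : nat) (K : {set 'I_N}).

Local Notation prob := (outcome_prob psi rho).
Local Notation theta := (purity K rho).
Let kern x y := outcome_kernel C K x y - theta.

Lemma purity_real : theta \is Num.real.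
Proof.
rewrite -(outcome_kernel_mean rho sic_psi); apply: rpred_sum => o _.
apply: rpredM; last exact: kernel_mean_real.
exact/ger0_real/outcome_prob_ge0.
Qed.

(** Passing from [m < m'] to ordered pairs doubles the sum, which cancels the 2 in the binomial;
    [1 < M] keeps the denominators nonzero. *)
Lemma phat_centered (w : {ffun 'I_M -> outcome N}) : (1 < M)%N ->
  phat psi K w - theta =
  (M%:R * (M%:R - 1))^-1 * \sum_m \sum_(m' | m != m') kern (w m) (w m').
Proof.
move=> M_gt1; have M_neq0 : M%:R != 0 :> C by rewrite pnatr_eq0 -lt0n ltnW.
have M1_neq0 : M%:R - 1 != 0 :> C by rewrite subr_eq0 -[1]/(1%:R) eqr_nat gtn_eqF.
have binM : 'C(M, 2)%:R = M%:R * (M%:R - 1) / 2%:R :> C.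
  have -> : M%:R - 1 = M.-1%:R :> C by rewrite -subn1 natrB // ltnW.
  rewrite -natrM; apply: (canRL (mulfK _)); first by rewrite pnatr_eq0.
  by rewrite -natrM -[X in (_ * X)%N]/(2`!) bin_ffact !ffactnS ffactn0 muln1.
have -> : \sum_m \sum_(m' | m != m') kern (w m) (w m') =
    \sum_m \sum_(m' | m != m') outcome_kernel C K (w m) (w m') - M%:R * (M%:R - 1) * theta.
  under eq_bigr => m _ do rewrite sumrB -[X in _ - \sum_(_ | _) X]mul1r -mulr_suml sum_neq_ord.
  by rewrite sumrB sumr_const card_ord -[(_ * theta) *+ _]mulr_natl mulrA.
rewrite sum_neq_sum_lt => [|i j]; last exact: outcome_kernel_sym.
rewrite /phat binM.
under eq_bigr => m _ do under eq_bigr => m' _ do rewrite (trace_shadow_mul sic_psi).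
by field; rewrite M1_neq0.
Qed.

Lemma phat_real (w : {ffun 'I_M -> outcome N}) : phat psi K w \is Num.real.
Proof.
rewrite rpredM ?rpredV ?realn //; apply: rpred_sum => m _; apply: rpred_sum => m' _.
by rewrite trace_shadow_mul // outcome_kernel_real.
Qed.

Lemma phat_variance_le : (1 < M)%N ->
  iid_mean prob (fun w : {ffun 'I_M -> outcome N} => (phat psi K w - theta) ^+ 2) <=
  4%:R * 3%:R ^+ #|K| / M%:R + 2%:R * 9%:R ^+ #|K| / (M%:R * (M%:R - 1)).
Proof.
move=> M_gt1; have M_gt0 : 0 < M%:R :> C by rewrite ltr0n ltnW.
have M1_gt0 : 0 < M%:R - 1 :> C by rewrite subr_gt0 -[1]/(1%:R) ltr_nat.
have p_sum1 := outcome_prob_sum1 rho_density sic_psi.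
have theta2_ge0 : 0 <= theta ^+ 2 by rewrite real_exprn_even_ge0 ?purity_real.
have mean_kern x : \sum_y prob y * kern x y = kernel_mean rho psi K x - theta.
  under eq_bigr => y _ do rewrite mulrBr.
  by rewrite sumrB -mulr_suml p_sum1 mul1r.
have mean_sqr (f : outcome N -> C) : \sum_x prob x * (f x - theta) ^+ 2 =
    \sum_x prob x * f x ^+ 2 - 2%:R * theta * (\sum_x prob x * f x) + theta ^+ 2.
  have -> : theta ^+ 2 = \sum_x prob x * theta ^+ 2 by rewrite -mulr_suml p_sum1 mul1r.
  rewrite mulr_sumr -sumrB -big_split.
  by apply: eq_bigr => x _ /=; ring.
have kern_mean0 : \sum_x prob x * (\sum_y prob y * kern x y) = 0.
  under eq_bigr => x _ do rewrite mean_kern mulrBr.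
  by rewrite sumrB -mulr_suml p_sum1 mul1r outcome_kernel_mean // subrr.
(* Centring lowers this second moment, and the next one, by exactly [theta ^+ 2], so the bounds for
   the uncentred kernel serve as [z1] and [z2]. *)
have z1_bound : \sum_x prob x * (\sum_y prob y * kern x y) ^+ 2 <= 3%:R ^+ #|K|.
  under eq_bigr => x _ do rewrite mean_kern.
  apply: le_trans (kernel_mean_sqr_mean_le rho_density sic_psi K).
  rewrite mean_sqr outcome_kernel_mean // -subr_ge0 [X in 0 <= X](_ : _ = theta ^+ 2) //.
  by ring.
have z2_bound : \sum_x prob x * (\sum_y prob y * kern x y ^+ 2) <= 9%:R ^+ #|K|.
  apply: le_trans (outcome_kernel_sqr_mean_le rho_density sic_psi K).
  under eq_bigr => x _ do rewrite mean_sqr 2!mulrDr mulrN mulrCA.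
  rewrite !big_split /= sumrN -mulr_sumr -mulr_suml p_sum1 outcome_kernel_mean //.
  rewrite -subr_ge0 [X in 0 <= X](_ : _ = theta ^+ 2) //.
  by ring.
have kern_sym x y : kern x y = kern y x by rewrite /kern outcome_kernel_sym.
have := ustat_second_moment M p_sum1 kern_sym kern_mean0 z1_bound z2_bound
  (exprn_ge0 _ (ler0n _ _)).
rewrite (@eq_iid_mean _ _ prob M (fun w => (phat psi K w - theta) ^+ 2) (fun w =>
  (M%:R * (M%:R - 1))^-1 ^+ 2 * (\sum_m \sum_(m' | m != m') kern (w m) (w m')) ^+ 2)); last first.
  by move=> w; rewrite phat_centered // exprMn.
rewrite iid_meanZ -(ler_pM2l (_ : 0 < ((M%:R * (M%:R - 1))^-1) ^+ 2)); last first.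
  by rewrite exprn_gt0 // invr_gt0 mulr_gt0.
move=> /le_trans; apply; rewrite le_eqVlt; apply/orP; left; apply/eqP.
by field; rewrite !gt_eqF.
Qed.

End PurityEstimator.

(** * From the variance bound to the sample size *)

Theorem mainTheorem6 (C : numClosedFieldType) (N : nat) (rho : op C N)
  (psi : 'I_4 -> 'I_2 -> C) (L : nat) (Ks : 'I_L -> {set 'I_N})
  (eps delta : C) (M : nat) :
  density rho -> sic psi ->
  0 < eps < 1 -> 0 < delta < 1 ->
  6%:R * L%:R * 3%:R ^+ (\max_(l < L) #|Ks l|) / (eps ^+ 2 * delta) <= M%:R ->
  1 - delta <=
    Pr (M := M) psi rho
      (fun w => [forall l : 'I_L,
                   `|phat psi (Ks l) w - purity (Ks l) rho| <= eps]).
Proof.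
move=> rho_density sic_psi /andP[eps_gt0 eps_lt1] /andP[delta_gt0 delta_lt1].
set k := \max_(l < L) _.
have ed_gt0 : 0 < eps ^+ 2 * delta by rewrite mulr_gt0 ?exprn_gt0.
rewrite ler_pdivrMr // => M_ge.
apply: (iid_chebyshev_union (outcome_prob_ge0 psi rho_density)
  (outcome_prob_sum1 rho_density sic_psi)
  (X := fun l w => phat psi (Ks l) w - purity (Ks l) rho)) => //.
  by move=> l w; rewrite rpredB ?(phat_real sic_psi) ?(purity_real rho_density sic_psi).
(* Without subsystems the hypothesis puts no positive lower bound on [M], but the sum is empty. *)
have [L0|L_gt0] := posnP L.
  by rewrite big1 ?(ltW ed_gt0) // => l _; have := ltn_ord l; rewrite {2}L0.
have M_ge_nat : (6 * L * 3 ^ k <= M)%N.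
  rewrite -(ler_nat C) !natrM natrX; apply: le_trans M_ge _.
  rewrite ler_piMr ?ler0n // mulr_ile1 ?exprn_ge0 ?exprn_ile1 //; exact: ltW.
(* Strictness yields 3^k <= M - 1, which reduces 9^k / (M (M - 1)) to 3^k / M. *)
have M_gt : (3 ^ k < M)%N.
  apply: leq_trans M_ge_nat; rewrite ltn_Pmull ?expn_gt0 //.
  by rewrite (leq_trans _ (leq_pmulr 6 L_gt0)).
have M_gt1 : (1 < M)%N by apply: leq_ltn_trans M_gt; rewrite expn_gt0.
have M_gt0 : 0 < M%:R :> C by rewrite ltr0n ltnW.
have M1_gt0 : 0 < M%:R - 1 :> C by rewrite subr_gt0 -[1]/(1%:R) ltr_nat.
have pow3_le : 3%:R ^+ k <= M%:R - 1 :> C.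
  by rewrite lerBrDr -natrX natr1 ler_nat.
(* The 6 splits as 4 for the conditional mean plus 2 for the mean square; [L] such terms stay below
   [eps ^+ 2 * delta] by the choice of [M]. *)
apply: (@le_trans _ _ (\sum_(l < L) 6%:R * 3%:R ^+ k / M%:R)); last first.
  rewrite sumr_const card_ord -[X in X <= _]mulr_natr mulrAC ler_pdivrMr //.
  by rewrite mulrAC [X in _ <= X]mulrC.
apply: ler_sum => l _.
apply: le_trans (phat_variance_le rho_density sic_psi (Ks l) M_gt1) _.
have card_le : (#|Ks l| <= k)%N by exact: leq_bigmax.
apply: (@le_trans _ _ (4%:R * 3%:R ^+ k / M%:R + 2%:R * 9%:R ^+ k / (M%:R * (M%:R - 1)))).
  by apply: lerD; rewrite ler_wpM2r ?invr_ge0 ?mulr_ge0 ?(ltW M_gt0) ?(ltW M1_gt0) //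
     ler_wpM2l ?ler0n // ler_weXn2l // ler1n.
have -> : 6%:R * 3%:R ^+ k / M%:R = 4%:R * 3%:R ^+ k / M%:R + 2%:R * 3%:R ^+ k / M%:R :> C.
  by ring.
rewrite lerD2l invfM mulrA mulrAC ler_wpM2r ?invr_ge0 ?(ltW M_gt0) //.
rewrite ler_pdivrMr // -mulrA ler_wpM2l ?ler0n //.
have -> : 9%:R = 3%:R * 3%:R :> C by rewrite -natrM.
by rewrite exprMn ler_wpM2l ?exprn_ge0 ?ler0n.
Qed.
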